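(* Let $n\geq 1$ and $k\geq 2$ be integers, and let $w$ be a length-$n$ word over $\Sigma_k$. Then $\operatorname{rankB}_k(w)$ can be computed (from $w$ and $k$) in $O(kn^3)$ time using $O(n)$ space, under the unit-cost RAM model.
   Context: $\Sigma_k=\{1,2,\ldots,k\}$ with $1<2<\cdots<k$, and $\Sigma_k^n$ is the set of length-$n$ words over $\Sigma_k$. Lexicographic order: for $x=x_1\cdots x_m$ and $y=y_1\cdots y_n$, $x<y$ if $x$ is a proper prefix of $y$, or if $x_i<y_i$ for the smallest $i$ with $x_i\neq y_i$. A border of a word $w$ is a word that is both a non-empty proper prefix and a non-empty proper suffix of $w$; $w$ is bordered if it has a border and unbordered otherwise. $\operatorname{rankB}_k(w)$ denotes the rank (position, starting from $1$) of $w$ in the lexicographic listing of all bordered words of length $|w|$ over $\Sigma_k$; for an arbitrary word $w$ of length $n$ this is taken to mean $1$ plus the number of length-$n$ bordered words over $\Sigma_k$ that are lexicographically smaller than $w$. Unit-cost RAM model: integer variables use constant space and integer arithmetic operations take constant time. *)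

(* Defs.v *)
From Stdlib Require Import ZArith.
From mathcomp Require Import all_boot.
Set Implicit Arguments. Unset Strict Implicit. Unset Printing Implicit Defensive.

Definition word_over (k : nat) (w : seq nat) : bool :=
  all (fun a => (1 <= a <= k)%N) w.

Definition bordered (w : seq nat) : bool :=
  [exists i : 'I_(size w), (0 < i)%N && (take i w == drop (size w - i) w)].

Fixpoint lexlt (x y : seq nat) : bool :=
  match x, y with
  | [::], [::] => false
  | [::], _ :: _ => true
  | _ :: _, [::] => false
  | a :: x', b :: y' => (a < b)%N || ((a == b) && lexlt x' y')
  end.

(* letter i : 'I_k  represents the letter i+1 of Sigma_k *)
Definition word_of (n k : nat) (v : n.-tuple 'I_k) : seq nat :=
  [seq (val i).+1 | i <- v].

Definition rankB (k : nat) (w : seq nat) : nat :=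
  (#|[pred v : (size w).-tuple 'I_k |
       bordered (word_of v) && lexlt (word_of v) w]|).+1.

(* Registers indexed by nat, each holding an unbounded integer (Z).    *)
(* Each instruction costs one time unit; arithmetic on registers is     *)
(* constant time.  Space = number of registers 0..m where m is the      *)
(* largest register address accessed during the run.                   *)

Inductive instr : Type :=
| IConst of nat & Z
| IAdd of nat & nat & nat
| ISub of nat & nat & nat
| IMul of nat & nat & nat
| IDiv of nat & nat & nat      (* r[d] := r[a] / r[b]  (floor; 0 if r[b]=0) *)
| ILoad of nat & nat
| IStore of nat & nat
| IJz of nat & nat
| IJneg of nat & nat
| IJmp of nat
| IHalt.

Definition program := seq instr.
Definition memory := nat -> Z.
Definition config := (nat * memory)%type.

Definition upd (m : memory) (d : nat) (z : Z) : memory :=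
  fun i => if i == d then z else m i.

(* one step; None means the machine has halted
   (Halt instruction, or program counter outside the program) *)
Definition step (P : program) (c : config) : option config :=
  let: (pc, m) := c in
  match nth IHalt P pc with
  | IConst d z => Some (pc.+1, upd m d z)
  | IAdd d a b => Some (pc.+1, upd m d (m a + m b)%Z)
  | ISub d a b => Some (pc.+1, upd m d (m a - m b)%Z)
  | IMul d a b => Some (pc.+1, upd m d (m a * m b)%Z)
  | IDiv d a b => Some (pc.+1, upd m d (m a / m b)%Z)
  | ILoad d a => Some (pc.+1, upd m d (m (Z.to_nat (m a))))
  | IStore a s => Some (pc.+1, upd m (Z.to_nat (m a)) (m s))
  | IJz r l => Some (if (m r =? 0)%Z then l else pc.+1, m)
  | IJneg r l => Some (if (m r <? 0)%Z then l else pc.+1, m)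
  | IJmp l => Some (l, m)
  | IHalt => None
  end.

Definition touched (P : program) (c : config) : nat :=
  let: (pc, m) := c in
  match nth IHalt P pc with
  | IConst d _ => d
  | IAdd d a b | ISub d a b | IMul d a b | IDiv d a b => maxn d (maxn a b)
  | ILoad d a => maxn d (maxn a (Z.to_nat (m a)))
  | IStore a s => maxn a (maxn s (Z.to_nat (m a)))
  | IJz r _ | IJneg r _ => r
  | IJmp _ | IHalt => 0
  end.

Fixpoint exec (P : program) (t : nat) (c : config) : option (config * nat) :=
  match t with
  | 0 => if step P c is None then Some (c, 0) else None
  | t'.+1 =>
      match step P c with
      | None => None
      | Some c' =>
          match exec P t' c' with
          | None => None
          | Some (cf, mx) => Some (cf, maxn (touched P c) mx)
          end
      end
  end.

(* Input convention: r[0] = k, r[1] = n = |w|, r[i+2] = w_i (0-based),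
   all other registers 0; program counter 0.  Output: r[0] at halt. *)
Definition init_mem (k : nat) (w : seq nat) : memory :=
  fun i => match i with
           | 0 => Z.of_nat k
           | 1 => Z.of_nat (size w)
           | j.+2 => if (j < size w)%N then Z.of_nat (nth 0 w j) else 0%Z
           end.

Definition init_config (k : nat) (w : seq nat) : config := (0, init_mem k w).

(* Main.v *)
Require Import Defs.
From Stdlib Require Import ZArith.
From mathcomp Require Import all_boot zify.

(** Shift letters to digits, so that the words below [w] are counted by the
    base-[k] value of [w]; it remains to subtract the unbordered ones.  A word
    is below [w] iff it extends exactly one prefix [p = w_1 ... w_i d] with
    [d < w_(i+1)], so it suffices to count, for each of these at most [k n]
    prefixes, the unbordered words of length [n] that extend [p], in time
    [O(n^2)].  Let [f N] be the number of unbordered words of length [N]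
    compatible with [p] (one is a prefix of the other).  A bordered word has a
    unique unbordered border, its shortest one, of length [j <= N / 2]; hence
    [k ^ (N - |p|) = f N + sum_(1 <= j <= N / 2) f j * c N j], where [c N j] is
    a power of [k], or 0 or 1 according to whether [p] overlaps itself.  With
    unit-cost arithmetic the overlap is tested in constant time by comparing
    base-[k] values of factors of [p], obtained from those of its prefixes. *)

(** * Words and shortest borders *)

Definition words (k N : nat) : seq (seq nat) :=
  [seq [seq val i | i <- tval v] | v <- enum {: N.-tuple 'I_k}].

Lemma words_uniq k N : uniq (words k N).
Proof.
by rewrite map_inj_uniq ?enum_uniq // => u v /(inj_map val_inj)/val_inj.
Qed.

Lemma mem_words k N u : (u \in words k N) = (size u == N) && all (ltn^~ k) u.
Proof.
apply/mapP/andP => [[v _ ->]|[/eqP su /allP ku]].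
  by rewrite size_map size_tuple; split=> //; apply/allP => x /mapP[i _ ->] /=.
have sv : size (pmap (insub : nat -> option 'I_k) u) == N.
  rewrite size_pmap_sub -su -all_count; exact/allP.
exists (Tuple sv); first by rewrite mem_enum.
rewrite /= pmap_filter; last by move=> x; exact: insubK.
apply/esym/all_filterP/allP => x /ku kx.
by rewrite /isSome insubT.
Qed.

Lemma size_words k N : size (words k N) = k ^ N.
Proof. by rewrite size_map -cardE card_tuple card_ord. Qed.

Lemma card_words k N (P : pred (seq nat)) :
  #|[pred v : N.-tuple 'I_k | P [seq val i | i <- v]]| = count P (words k N).
Proof.
rewrite -sum1_count big_map big_enum_cond -sum1_card.
by apply: eq_bigl => v; rewrite inE.
Qed.

(** Trivially true for [j = 0] and for [j >= size v]; proper borders are selected by restricting the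
    range of [j]. *)
Definition border_at (j : nat) (v : seq nat) : bool :=
  take j v == drop (size v - j) v.

Lemma border_atP j v : j <= size v ->
  reflect (forall x, x < j -> nth 0 v x = nth 0 v (size v - j + x))
          (border_at j v).
Proof.
move=> jv; apply: (iffP eqP) => [E x xj|E].
  by rewrite -nth_drop -E nth_take.
apply: (@eq_from_nth _ 0); first by rewrite size_takel // size_drop; lia.
by move=> x; rewrite size_takel // => xj; rewrite nth_take // nth_drop E.
Qed.

Lemma borderedP v :
  reflect (exists2 j, 0 < j < size v & border_at j v) (bordered v).
Proof.
apply: (iffP existsP) => [[i /andP[i0 E]]|[j /andP[j0 jv] E]].
  by exists (i : nat) => //; rewrite i0 ltn_ord.
by exists (Ordinal jv); rewrite j0.
Qed.

(** Since [take j v] also ends [v], its suffix of length [i] is the suffix of [v] of that length. *)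
Lemma border_at_take i j v : i <= j -> j <= size v -> border_at j v ->
  border_at i (take j v) = border_at i v.
Proof.
move=> ij jv /eqP E; rewrite /border_at size_takel // take_takel //.
by rewrite {1}E drop_drop; congr (_ == drop _ _); lia.
Qed.

(** The least border length serves: by [border_at_take], a border of that prefix would be a shorter
    border of [v]. *)
Lemma shortest_border v : bordered v ->
  exists2 j, 0 < j <= (size v)./2 & border_at j v && ~~ bordered (take j v).
Proof.
move=> /borderedP[j1 Hj1 B1].
have ex : exists j, (0 < j < size v) && border_at j v by exists j1; rewrite Hj1.
case: (ex_minnP ex) => j /andP[/andP[j0 jv] B] minj.
exists j; last first.
  rewrite B; apply/borderedP => -[i]; rewrite size_takel ?(ltnW jv) // => /andP[i0 ij].
  rewrite border_at_take ?(ltnW ij) ?(ltnW jv) // => Bi.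
  have := minj i; rewrite i0 Bi (ltn_trans ij jv) /= => /(_ isT); lia.
rewrite j0 /= leqNgt; apply/negP => big.
(* Overlapping occurrences of a border leave the shorter border 2j - |v|. *)
have Bi : border_at (j + j - size v) v.
  apply/border_atP; first lia.
  move=> x Hx; move/border_atP: B => /(_ (ltnW jv)) B.
  rewrite B; last lia.
  rewrite B; last lia.
  by congr (nth _ _ _); lia.
have := minj (j + j - size v); rewrite Bi andbT.
have -> : 0 < j + j - size v < size v by lia.
move=> /(_ isT); lia.
Qed.

(** At most one term is non-zero, since of two borders of [v] the shorter is a border of the
    longer. *)
Lemma bordered_sum v :
  (bordered v : nat) =
  \sum_(1 <= j < (size v)./2.+1) (border_at j v && ~~ bordered (take j v)).
Proof.
case: (boolP (bordered v)) => [bv|/negP nbv]; last first.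
  rewrite big_nat big1 // => j Hj; case: (boolP (border_at j v)) => //= B.
  by case: nbv; apply/borderedP; exists j => //; lia.
have [j Hj Bj] := shortest_border _ bv.
rewrite (bigD1_seq j) ?iota_uniq ?mem_index_iota //= Bj big_seq_cond big1 ?addn0 //.
move=> i /andP[]; rewrite mem_index_iota => Hi ij.
have main a b : 0 < a < b -> b <= (size v)./2 -> border_at a v ->
    border_at b v -> bordered (take b v).
  move=> ab bs Ba Bb; apply/borderedP; exists a; first by rewrite size_takel; lia.
  by rewrite border_at_take //; lia.
case: (boolP (border_at i v)) => //= Bi; case/andP: Bj => Bj ubj.
case: (ltngtP i j) => lij; last by rewrite lij eqxx in ij.
  by move: ubj; rewrite (main i j) //; lia.
by rewrite (main j i) //; lia.
Qed.

(** Counting a class of words amounts to listing it without repetition. *)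
Lemma count_words k N (P : pred (seq nat)) (t : seq (seq nat)) : uniq t ->
  (forall u : seq nat, (u \in t) = [&& size u == N, all (ltn^~ k) u & P u]) ->
  count P (words k N) = size t.
Proof.
move=> ut Et; rewrite -size_filter; apply/perm_size/uniq_perm => //.
  exact/filter_uniq/words_uniq.
by move=> u; rewrite mem_filter mem_words Et andbC -andbA.
Qed.

(** * Counting the words compatible with a prefix *)

Definition compat (p v : seq nat) : bool := take (size p) v == take (size v) p.

Definition unbordered_count (k : nat) (p : seq nat) (N : nat) : nat :=
  count (fun v => ~~ bordered v && compat p v) (words k N).

(* The number of words of length N compatible with p that begin and end with a
   given word b of length j <= N / 2 compatible with p: if the final b overlaps
   p, this is decided by whether p has the corresponding border. *)
Definition coef (k : nat) (p : seq nat) (N j : nat) : nat :=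
  let e := minn N (size p) in
  if N - j < size p then (take (e - (N - j)) p == drop (N - j) (take e p) : nat)
  else k ^ (N - j - maxn (size p) j).

Lemma all_take (T : Type) (a : pred T) i s : all a s -> all a (take i s).
Proof. by rewrite -{1}(cat_take_drop i s) all_cat => /andP[]. Qed.

Lemma all_drop (T : Type) (a : pred T) i s : all a s -> all a (drop i s).
Proof. by rewrite -{1}(cat_take_drop i s) all_cat => /andP[]. Qed.

Lemma compat_long p v : size p <= size v -> compat p v = (take (size p) v == p).
Proof. by move=> pv; rewrite /compat (take_oversize pv). Qed.

Lemma compat_short p v : size v <= size p -> compat p v = (v == take (size v) p).
Proof. by move=> pv; rewrite /compat (take_oversize pv). Qed.

(** If [p] is longer than [N], the truncated exponent is 0, matching the single compatible word
    [take N p]. *)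
Lemma count_compat k p N : all (ltn^~ k) p ->
  count (compat p) (words k N) = k ^ (N - size p).
Proof.
move=> kp; case: (leqP (size p) N) => pN.
  rewrite (@count_words _ _ _ [seq p ++ z | z <- words k (N - size p)]).
  - by rewrite size_map size_words.
  - by rewrite map_inj_uniq ?words_uniq // => x y /eqP; rewrite eqseq_cat // => /andP[_ /eqP].
  move=> u; apply/mapP/and3P => [[z]|[/eqP su ku]].
    rewrite mem_words => /andP[/eqP sz kz] ->; rewrite size_cat sz all_cat kp kz.
    split=> //; first by rewrite subnKC.
    by rewrite compat_long ?size_cat ?leq_addr // take_size_cat.
  rewrite compat_long ?su // => /eqP Ep; exists (drop (size p) u).
    by rewrite mem_words size_drop su eqxx all_drop.
  by rewrite -{1}Ep cat_take_drop.
have -> : N - size p = 0 by lia.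
rewrite (@count_words _ _ _ [:: take N p]) //.
move=> u; rewrite inE; apply/eqP/and3P => [->|[/eqP su ku]].
  have sN : size (take N p) = N by rewrite size_takel // ltnW.
  by rewrite sN all_take // compat_short sN // ltnW.
by rewrite compat_short ?su ?(ltnW pN) // => /eqP.
Qed.

Lemma unbordered_count_short k p N : all (ltn^~ k) p -> N <= size p ->
  unbordered_count k p N = ~~ bordered (take N p).
Proof.
move=> kp Np; have sN : size (take N p) = N by rewrite size_takel.
rewrite /unbordered_count.
rewrite (@count_words _ _ _ (if bordered (take N p) then [::] else [:: take N p])).
- by case: ifP.
- by case: ifP.
move=> u; apply/idP/and3P => [|[/eqP su ku /andP[bu]]].
  case: ifP => // bp; rewrite inE => /eqP ->.
  by rewrite sN bp all_take // compat_short sN ?eqxx.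
by rewrite compat_short su // => /eqP E; rewrite -E (negbTE bu) inE.
Qed.

(** As [2j <= size v], the two occurrences of the border do not overlap. *)
Lemma border_split j v : j + j <= size v -> border_at j v ->
  v = take j v ++ take (size v - (j + j)) (drop j v) ++ take j v.
Proof.
move=> jv /eqP B; rewrite {2}B.
have -> : drop (size v - j) v = drop (size v - (j + j)) (drop j v).
  by rewrite drop_drop; congr drop; lia.
by rewrite !cat_take_drop.
Qed.

(** Such words are [b ++ z ++ b] with [b] unbordered. Either [p] fits inside the first [b], and [z]
    is free; or [b] is a prefix of [p], hence forced, and the final [b] starts inside [p], which
    leaves at most one word, or after it, which leaves only the letters in between free. *)
Lemma count_border k p N j : all (ltn^~ k) p -> 0 < j -> j + j <= N ->
  count (fun v => [&& compat p v, border_at j v & ~~ bordered (take j v)])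
        (words k N) = unbordered_count k p j * coef k p N j.
Proof.
move=> kp j0 jN.
case: (leqP (size p) j) => pj.
- rewrite /coef ifF; last by lia.
  rewrite (@count_words _ _ _
    [seq b ++ z ++ b | b <- [seq v <- words k j | ~~ bordered v && compat p v],
                       z <- words k (N - (j + j))]).
  + rewrite size_allpairs size_filter size_words.
    by congr (_ * _ ^ _); lia.
  + apply: allpairs_uniq; rewrite ?filter_uniq ?words_uniq //.
    move=> [b z] [b' z'] /allpairsP[[x y] /= [+ _ [-> ->]]].
    rewrite mem_filter mem_words => /andP[_ /andP[/eqP sx _]].
    move=> /allpairsP[[x' y'] /= [+ _ [-> ->]]].
    rewrite mem_filter mem_words => /andP[_ /andP[/eqP sx' _]] /eqP.
    rewrite eqseq_cat ?sx ?sx' // => /andP[/eqP -> /eqP E]; congr (_, _).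
    (* Reversal turns the common suffix into a common prefix, which can be cancelled. *)
    by have := congr1 rev E; rewrite !rev_cat => /eqP;
       rewrite eqseq_cat // => /andP[_ /eqP/(can_inj revK)].
  move=> u; apply/allpairsP/and3P => [[[b z] /= [+ + ->]]|].
    rewrite mem_filter !mem_words => /andP[/andP[ub cb] /andP[/eqP sb kb]] /andP[/eqP sz kz].
    rewrite !size_cat !all_cat kb kz sb sz.
    split=> //; first by lia.
    rewrite /border_at take_size_cat // ub andbT.
    rewrite catA drop_size_cat ?size_cat ?sb; last by lia.
    rewrite eqxx andbT -catA compat_long ?size_cat ?sb; last lia.
    by rewrite takel_cat ?sb // -compat_long ?sb.
  move=> [/eqP su ku /and3P[cu Bu ubu]].
  exists (take j u, take (size u - (j + j)) (drop j u)) => /=; split.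
  + rewrite mem_filter mem_words ubu all_take // size_takel ?su ?eqxx ?andbT; last lia.
    rewrite /= compat_long ?size_takel ?su //; try lia.
    by move: cu; rewrite compat_long ?su ?take_takel //; lia.
  + by rewrite mem_words size_takel ?size_drop su ?eqxx ?all_take ?all_drop //; lia.
  + by rewrite -border_split // su.
rewrite (unbordered_count_short _ _ _ kp (ltnW pj)) /coef.
have sj : size (take j p) = j by rewrite size_takel // ltnW.
case: ltnP => ov.
(* [s] is where the final copy of the border starts, and [e] is the length of the part of [p] that a
   word of length [N] covers; the copy must agree with [p] between [s] and [e]. *)
- set e := minn _ _; set s := N - j in ov *.
  set test := _ == drop s _.
  have ss : size (take s p) = s by rewrite size_takel // ltnW.
  have Hcompat : compat p (take s p ++ take j p) = test.
    rewrite /compat size_cat ss sj (_ : s + j = N); last by lia.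
    rewrite /test.
    have -> : take N p = take e p.
      by rewrite /e; case: (leqP N (size p)) => Np //;
         rewrite take_size take_oversize // ltnW.
    have -> : take (size p) (take s p ++ take j p) = take s p ++ take (e - s) p.
      rewrite take_cat ss ifF; last by lia.
      congr cat; rewrite /e; case: (leqP N (size p)) => Np.
        by rewrite take_oversize ?sj; [congr take|]; lia.
      by rewrite take_takel //; lia.
    rewrite -{1}(cat_take_drop s (take e p)) take_takel; last by rewrite /e; lia.
    by rewrite eqseq_cat // eqxx.
  rewrite (@count_words _ _ _
    (if ~~ bordered (take j p) && test then [:: take s p ++ take j p] else [::])).
  + by case: (bordered _) => //=; case: ifP.
  + by case: ifP.
  move=> u; apply/idP/and3P.
    case: ifP => // /andP[ub ts]; rewrite inE => /eqP ->.
    rewrite size_cat ss sj all_cat !all_take // Hcompat ts.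
    have tj : take j (take s p ++ take j p) = take j p.
      rewrite take_cat ss; case: ltnP => js; first by rewrite take_takel // ltnW.
      have sjE : s = j by rewrite /s; lia.
      by rewrite sjE subnn take0 cats0.
    rewrite /border_at tj ub size_cat ss sj drop_size_cat ?eqxx ?ss; try lia.
    by split=> //; lia.
  move=> [/eqP su ku /and3P[cu Bu ubu]].
  have Es : take s u = take s p.
    move: cu => /eqP/(congr1 (take s)); rewrite !take_takel //; lia.
  have Ej : take j u = take j p.
    by move/(congr1 (take j)): Es; rewrite !take_takel //; lia.
  have Eu : u = take s p ++ take j p.
    by rewrite -{1}(cat_take_drop s u) Es; congr cat; rewrite -Ej (eqP Bu) su.
  by rewrite -Hcompat -Eu cu -Ej ubu inE.
rewrite (@count_words _ _ _ (if bordered (take j p) then [::] else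
   [seq p ++ z ++ take j p | z <- words k (N - j - size p)])).
- case: bordered => //; rewrite mul1n size_map size_words; congr (_ ^ _); lia.
- case: ifP => // _; rewrite map_inj_uniq ?words_uniq // => x y /eqP.
  rewrite eqseq_cat // eqxx /= => /eqP E.
  by have := congr1 rev E; rewrite !rev_cat => /eqP;
     rewrite eqseq_cat // => /andP[_ /eqP/(can_inj revK)].
move=> u; apply/idP/and3P.
  case: ifP => // ub /mapP[z]; rewrite mem_words => /andP[/eqP sz kz] ->.
  rewrite /border_at !all_cat kp kz all_take // !size_cat sz sj take_cat pj ub.
  rewrite compat_long ?size_cat ?leq_addr // take_size_cat // eqxx.
  rewrite catA drop_size_cat ?size_cat ?sz ?eqxx; try lia.
  by split=> //; lia.
move=> [/eqP su ku /and3P[cu Bu ubu]].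
move: cu; rewrite compat_long ?su; last lia.
move=> /eqP Ep.
have Ej : take j u = take j p by rewrite -Ep take_takel // ltnW.
rewrite -Ej ifN //; apply/mapP; exists (take (N - j - size p) (drop (size p) u)).
  by rewrite mem_words size_takel ?size_drop ?su ?eqxx ?all_take ?all_drop //; lia.
rewrite (eqP Bu) su (_ : drop (N - j) u = drop (N - j - size p) (drop (size p) u)).
  by rewrite cat_take_drop -{1}Ep cat_take_drop.
by rewrite drop_drop; congr drop; lia.
Qed.

(** The compatible words split into the unbordered ones and, by [bordered_sum], the bordered ones
    sorted by the length of their shortest border. Every [j] in the sum is below [N], so the
    identity determines the count for [N] from earlier ones. *)
Lemma unbordered_count_rec k p N : all (ltn^~ k) p ->
  unbordered_count k p N +
  \sum_(1 <= j < N./2.+1) unbordered_count k p j * coef k p N j = k ^ (N - size p).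
Proof.
move=> kp; rewrite -(count_compat _ _ N kp).
have -> : \sum_(1 <= j < N./2.+1) unbordered_count k p j * coef k p N j =
    count (fun v => bordered v && compat p v) (words k N).
  rewrite -sum1_count (eq_big_nat _ _
    (F2 := fun j => \sum_(v <- words k N)
      nat_of_bool [&& compat p v, border_at j v & ~~ bordered (take j v)])); last first.
    move=> j Hj; rewrite -count_border //; try lia.
    by rewrite -sum1_count big_mkcond.
  rewrite exchange_big [RHS]big_mkcond /=; apply: eq_big_seq => v.
  rewrite mem_words => /andP[/eqP sv _].
  case: (compat p v); rewrite ?andbF ?andbT /=; last by rewrite big1.
  by have := bordered_sum v; rewrite sv => <-; case: bordered.
rewrite /unbordered_count -!sum1_count [RHS](bigID bordered) /= addnC.
by congr (_ + _); apply: eq_bigl => v; rewrite andbC.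
Qed.

(** * Ranks in base k *)

Definition digits_val (k : nat) (u : seq nat) : nat :=
  foldl (fun a d => a * k + d) 0 u.

Lemma digits_val_rcons k u d : digits_val k (rcons u d) = digits_val k u * k + d.
Proof. by rewrite /digits_val foldl_rcons. Qed.

Lemma digits_val_cat k u v :
  digits_val k (u ++ v) = digits_val k u * k ^ size v + digits_val k v.
Proof.
elim/last_ind: v => [|v d IH]; first by rewrite cats0 muln1 addn0.
by rewrite -rcons_cat !digits_val_rcons IH size_rcons expnS; nia.
Qed.

Lemma digits_val_inj k u v : all (ltn^~ k) u -> all (ltn^~ k) v ->
  size u = size v -> digits_val k u = digits_val k v -> u = v.
Proof.
elim/last_ind: u v => [|u a IH] v; first by case: v.
case/lastP: v => [|v b]; first by rewrite size_rcons.
rewrite !all_rcons !size_rcons !digits_val_rcons => /andP[ak ku] /andP[bk kv] [suv] E.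
have k0 : 0 < k by case: (k) ak.
have Eab : a = b by have := congr1 (modn^~ k) E; rewrite /= !modnMDl !modn_small.
rewrite Eab in E *; congr rcons; apply: IH => //.
by apply/eqP; rewrite -(eqn_pmul2r k0) -(eqn_add2r b) E.
Qed.

(** The value of [drop s (take e p)] is that of [take e p] minus a shift of that of [take s p], and
    words of equal length are equal as soon as their values are. Only values of prefixes and powers
    of [k] enter. *)
Lemma overlap_digits_val k p s e : all (ltn^~ k) p -> s <= e <= size p ->
  (take (e - s) p == drop s (take e p)) =
  (digits_val k (take e p) ==
   digits_val k (take s p) * k ^ (e - s) + digits_val k (take (e - s) p)).
Proof.
move=> kp /andP[se ep].
have sd : size (drop s (take e p)) = e - s by rewrite size_drop size_takel.
rewrite -{2}(cat_take_drop s (take e p)) take_takel // digits_val_cat sd.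
rewrite eqn_add2l; apply/eqP/eqP => [->//|E].
apply: (@digits_val_inj k) => //; rewrite ?all_drop ?all_take //.
by rewrite sd size_takel //; lia.
Qed.

(** If [v] is below [u], the words first differ at some position [i], and exactly the term for this
    [i] and the letter [d] of [v] there equals 1. *)
Lemma lexlt_sum u v : size v = size u ->
  (lexlt v u : nat) =
  \sum_(0 <= i < size u) \sum_(0 <= d < nth 0 u i) compat (rcons (take i u) d) v.
Proof.
elim: u v => [|b u IH] [|a v] //=; first by rewrite big_nil.
case=> suv; rewrite big_nat_recl //=.
have -> : \sum_(0 <= d < b) compat [:: d] (a :: v) = (a < b).
  have E d : compat [:: d] (a :: v) = (a == d).
    by rewrite /compat /= take0 eqseq_cons eqxx andbT.
  case: (ltnP a b) => ab.
    rewrite (bigD1_seq a) ?iota_uniq ?mem_index_iota //= E eqxx big1 ?addn0 //.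
    by move=> d da; rewrite E eq_sym (negbTE da).
  rewrite big_nat big1 // => d Hd; rewrite E.
  by have -> : (a == d) = false by lia.
have -> : \sum_(0 <= i < size u) \sum_(0 <= d < nth 0 u i)
     compat (b :: rcons (take i u) d) (a :: v) = (a == b) && lexlt v u.
  case: (eqVneq a b) => [->|ab] /=.
    rewrite IH //; apply: eq_bigr => i _; apply: eq_bigr => d _.
    by rewrite /compat /= eqseq_cons eqxx.
  rewrite big1 // => i _; rewrite big1 // => d _.
  by rewrite /compat /= eqseq_cons (negbTE ab).
by case: (ltngtP a b).
Qed.

Lemma count_lexlt k u (P : pred (seq nat)) :
  count (fun v => P v && lexlt v u) (words k (size u)) =
  \sum_(0 <= i < size u) \sum_(0 <= d < nth 0 u i)
    count (fun v => P v && compat (rcons (take i u) d) v) (words k (size u)).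
Proof.
transitivity (\sum_(v <- words k (size u)) \sum_(0 <= i < size u)
    \sum_(0 <= d < nth 0 u i) (P v && compat (rcons (take i u) d) v)); last first.
  rewrite exchange_big /=; apply: eq_bigr => i _.
  rewrite exchange_big /=; apply: eq_bigr => d _.
  by rewrite -sum1_count [RHS]big_mkcond.
rewrite -sum1_count big_mkcond /=; apply: eq_big_seq => v.
rewrite mem_words => /andP[/eqP sv _].
case: (P v) => /=; first by rewrite -lexlt_sum //; case: lexlt.
by rewrite big1 // => i _; rewrite big1.
Qed.

Lemma digits_val_sum k u :
  digits_val k u = \sum_(0 <= i < size u) nth 0 u i * k ^ (size u - i.+1).
Proof.
elim: u => [|a u IH]; first by rewrite big_nil.
rewrite -cat1s digits_val_cat big_nat_recl //= IH subSS subn0.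
by congr (_ + _); apply: eq_bigr => i _; rewrite subSS.
Qed.

Lemma bordered_map (f : nat -> nat) u : injective f -> bordered [seq f x | x <- u] = bordered u.
Proof.
move=> fI; apply/borderedP/borderedP; rewrite size_map => -[j Hj B]; exists j => //.
  by move: B; rewrite /border_at size_map -map_take -map_drop (inj_eq (inj_map fI)).
by rewrite /border_at size_map -map_take -map_drop (inj_eq (inj_map fI)).
Qed.

Lemma lexlt_succ u v : lexlt [seq x.+1 | x <- u] [seq x.+1 | x <- v] = lexlt u v.
Proof. by elim: u v => [|a u IH] [|b v] //=; rewrite IH ltnS eqSS. Qed.

(** Applied to all words, [count_lexlt] finds [digits_val k u] words below [u], as the prefix ending
    at position [i] has [k ^ (size u - i.+1)] extensions. Stating the result as a sum avoids
    truncated subtraction. *)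
Lemma rankB_succ k u : all (ltn^~ k) u ->
  rankB k [seq x.+1 | x <- u] +
  \sum_(0 <= i < size u) \sum_(0 <= d < nth 0 u i)
     unbordered_count k (rcons (take i u) d) (size u) = (digits_val k u).+1.
Proof.
move=> ku.
have -> : rankB k [seq x.+1 | x <- u] =
    (count (fun v => bordered v && lexlt v u) (words k (size u))).+1.
  rewrite /rankB size_map -card_words; congr S; apply: eq_card => v; rewrite !inE.
  have -> : word_of v = [seq x.+1 | x <- [seq val i | i <- v]].
    by rewrite /word_of -map_comp.
  by rewrite bordered_map ?lexlt_succ //; exact: succn_inj.
rewrite addSn; congr S; rewrite /unbordered_count -(count_lexlt k u (predC bordered)).
transitivity (count (fun v => predT v && lexlt v u) (words k (size u))).
  rewrite -!sum1_count [RHS](bigID bordered) /=.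
  by congr (_ + _); apply: eq_bigl => v; rewrite andbC.
rewrite count_lexlt digits_val_sum; apply: eq_big_nat => i Hi.
rewrite (eq_big_nat _ _ (F2 := fun=> k ^ (size u - i.+1))).
  by rewrite sum_nat_const_nat subn0.
move=> d Hd; have uik : nth 0 u i < k by apply: (allP ku); rewrite mem_nth.
rewrite count_compat; last by rewrite all_rcons all_take // andbT /=; lia.
by rewrite size_rcons size_takel // ltnW.
Qed.

(** * Structured programs for the RAM *)

(** [WhileLt x y] loops while register [x] is below register [y]; [If z r a b] runs [a] when
    register [r] is zero ([z] true) or negative ([z] false), and [b] otherwise. *)
Inductive cmd : Type :=
| Block of seq instr
| Seq of cmd & cmd
| WhileLt of nat & nat & cmd
| If of bool & nat & cmd & cmd.

Definition jump_if (z : bool) : nat -> nat -> instr := if z then IJz else IJneg.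

Definition taken (z : bool) (v : Z) : bool := if z then (v =? 0)%Z else (v <? 0)%Z.

(* Register 3 is scratch: the loop test overwrites it. *)
Fixpoint compile (c : cmd) (pc : nat) : seq instr :=
  match c with
  | Block s => s
  | Seq a b => let ca := compile a pc in ca ++ compile b (pc + size ca)
  | WhileLt x y b =>
      let cb := compile b (pc + 3) in
      [:: ISub 3 x y; IJneg 3 (pc + 3); IJmp (pc + 3 + size cb + 1)]
        ++ cb ++ [:: IJmp pc]
  | If z r a b =>
      let cb := compile b (pc + 1) in
      let ca := compile a (pc + 1 + size cb + 1) in
      [:: jump_if z r (pc + 1 + size cb + 1)] ++ cb
        ++ [:: IJmp (pc + 1 + size cb + 1 + size ca)] ++ ca
  end.

(** * Timed execution of code fragments and a program logic *)

Definition code_at (P : program) (pc : nat) (c : seq instr) : Prop :=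
  forall i, i < size c -> nth IHalt P (pc + i) = nth IHalt c i.

Lemma code_at_cat P pc c1 c2 : code_at P pc (c1 ++ c2) ->
  code_at P pc c1 /\ code_at P (pc + size c1) c2.
Proof.
move=> H; split=> i Hi.
  by rewrite H ?nth_cat ?Hi // size_cat; lia.
rewrite -addnA H ?size_cat ?ltn_add2l // nth_cat ifF; last by lia.
by congr (nth _ _ _); lia.
Qed.

Lemma code_at_head P pc i c : code_at P pc (i :: c) -> nth IHalt P pc = i.
Proof. by move=> /(_ 0 isT); rewrite addn0. Qed.

Lemma code_at_cons P pc i c :
  code_at P pc (i :: c) -> nth IHalt P pc = i /\ code_at P pc.+1 c.
Proof.
move=> H; split; first exact: code_at_head H.
by move: H; rewrite -cat1s => /code_at_cat[_]; rewrite addn1.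
Qed.

(** Unlike in [exec], the final configuration need not be halted, so runs of fragments compose. *)
Fixpoint reach (P : program) (S t : nat) (c c' : config) : Prop :=
  if t is t'.+1 then
    touched P c <= S /\ exists2 c1, step P c = Some c1 & reach P S t' c1 c'
  else c = c'.

Lemma reach_trans P S t1 t2 c c1 c2 :
  reach P S t1 c c1 -> reach P S t2 c1 c2 -> reach P S (t1 + t2) c c2.
Proof.
elim: t1 c => [|t1 IH] c /=; first by move=> ->.
by move=> [tS [c' st r1]] r2; split=> //; exists c' => //; exact: IH.
Qed.

Lemma reach_exec P S t c c' : reach P S t c c' -> step P c' = None ->
  exists2 mx, mx <= S & exec P t c = Some (c', mx).
Proof.
elim: t c => [|t IH] c /=; first by move=> -> ->; exists 0.
move=> [tS [c1 -> /IH r]] /r[mx mxS ->].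
by exists (maxn (touched P c) mx); rewrite // geq_max tS.
Qed.

(** Total correctness with a time bound [T] and an address bound [S]. Quantifying over the host
    program and the load address makes the rules compositional; control must leave at the end of the
    fragment. *)
Definition wp (c : cmd) (T S : nat) (Q : memory -> Prop) (m : memory) : Prop :=
  forall P pc, code_at P pc (compile c pc) ->
  exists t m', [/\ t <= T, reach P S t (pc, m) (pc + size (compile c pc), m') & Q m'].

Lemma wp_weaken c T T' S (Q Q' : memory -> Prop) m : wp c T S Q m -> T <= T' ->
  (forall m', Q m' -> Q' m') -> wp c T' S Q' m.
Proof.
move=> H TT QQ P pc /H[t [m' [tT r q]]]; exists t, m'.
by split=> //; [exact: leq_trans TT | exact: QQ].
Qed.

Lemma wp_seq c1 c2 T1 T2 S Q m :
  wp c1 T1 S (wp c2 T2 S Q) m -> wp (Seq c1 c2) (T1 + T2) S Q m.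
Proof.
move=> H P pc /= /code_at_cat[/H[t1 [m1 [tT1 r1 H2]]] /H2[t2 [m2 [tT2 r2 q]]]].
exists (t1 + t2), m2; split=> //; first by rewrite leq_add.
by rewrite size_cat addnA; apply: reach_trans r1 r2.
Qed.

Definition is_jump (i : instr) : bool :=
  match i with IJz _ _ | IJneg _ _ | IJmp _ | IHalt => true | _ => false end.

(** A non-jump acts alike at every address, so it can be run in a one-instruction program. *)
Definition effect (i : instr) (m : memory) : memory :=
  if step [:: i] (0, m) is Some (_, m') then m' else m.

Definition touch (i : instr) (m : memory) : nat := touched [:: i] (0, m).

Lemma wp_nil S (Q : memory -> Prop) m : Q m -> wp (Block [::]) 0 S Q m.
Proof. by move=> q P pc _; exists 0, m; rewrite /= addn0. Qed.

Lemma wp_cons i s T S Q m : ~~ is_jump i -> touch i m <= S ->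
  wp (Block s) T S Q (effect i m) -> wp (Block (i :: s)) T.+1 S Q m.
Proof.
move=> ji tS H P pc /= /code_at_cons[Ei /H[t [m' [tT r q]]]].
exists t.+1, m'; split=> //=; split.
  by move: tS; rewrite /touch /= Ei; case: (i) ji.
exists (pc.+1, effect i m); last by rewrite addnS -addSn.
by rewrite /effect /= Ei; case: (i) ji.
Qed.

(** The two extra units pay for the test and, after [b], for the jump over [a]. *)
Lemma wp_if z r a b Ta Tb S Q m : r <= S ->
  (taken z (m r) -> wp a Ta S Q m) -> (~~ taken z (m r) -> wp b Tb S Q m) ->
  wp (If z r a b) (maxn Ta Tb).+2 S Q m.
Proof.
move=> rS Ha Hb P pc; rewrite /compile -/compile.
set cb := compile b _; set ca := compile a _.
move=> /code_at_cat[/code_at_head E1 /code_at_cat[Cb /code_at_cat[/code_at_head E2 Ca]]].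
rewrite /= in Cb E2 Ca; rewrite !size_cat /=.
have St : step P (pc, m) = Some (if taken z (m r) then pc + 1 + size cb + 1 else pc + 1, m).
  by rewrite /step E1 /jump_if /taken (addn1 pc); case: (z).
have To : touched P (pc, m) <= S by rewrite /touched E1 /jump_if; case: (z).
case: (boolP (taken z (m r))) St => mr St.
  have [t [m' [tT rr q]]] := Ha mr P _ Ca.
  exists t.+1, m'; split=> //; first by lia.
  split=> //; exists (pc + 1 + size cb + 1, m) => //.
  by move: rr; rewrite -/ca; congr (reach _ _ _ _ (_, _)); lia.
have [t [m' [tT rr q]]] := Hb mr P _ Cb.
exists (1 + (t + 1)), m'; split=> //; first by lia.
apply: (@reach_trans _ _ _ _ _ (pc + 1, m)); first by split=> //; exists (pc + 1, m).
apply: (reach_trans _ _ _ _ _ _ _ rr).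
rewrite /= E2; split=> //.
exists (pc + 1 + size cb + 1 + size ca, m') => //.
by congr pair; lia.
Qed.

(** The loop test overwrites register 3, so [I] must tolerate that. Each round costs three
    instructions besides the body (subtraction, conditional jump, jump back), and so does the exit;
    [maxn a b] covers a start with [a > b]. *)
Lemma wp_while (I : nat -> memory -> Prop) x y c a b T S m :
  3 <= S -> x <= S -> y <= S ->
  (forall i m, I i m -> m x = Z.of_nat i /\ m y = Z.of_nat b) ->
  (forall i m z, I i m -> I i (upd m 3 z)) ->
  (forall i m, a <= i < b -> I i m -> wp c T S (I i.+1) m) ->
  I a m -> wp (WhileLt x y c) ((b - a) * (T + 3) + 3) S (I (maxn a b)) m.
Proof.
move=> S3 xS yS Ixy I3 Ic Ia P pc; rewrite /compile -/compile.
set cb := compile c _ => /code_at_cat[C0 /code_at_cat[C1 /code_at_head E4]].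
have E1 := code_at_head _ _ _ _ C0.
have := C0 1 isT; have := C0 2 isT; rewrite /= => E3 E2.
rewrite /= in C1 E4; rewrite !size_cat /=.
set fin := pc + _.
move dN : (b - a) => N.
elim: N a m Ia Ic dN => [|N IH] a m Ia Ic dN; have [mx my] := Ixy _ _ Ia;
  set m1 := upd m 3 (m x - m y)%Z; have I1 : I a m1 by exact: I3.
  exists 3, m1; split=> //; last by rewrite (_ : maxn a b = a) //; lia.
  rewrite /= E1; split; first by rewrite !geq_max S3 xS yS.
  exists (pc.+1, m1) => //; rewrite -addn1 /= E2; split=> //.
  exists (pc + 2, m1).
    rewrite /m1 /upd /= mx my; case: Z.ltb_spec => [H|_]; first by lia.
    by congr (Some (_, _)); lia.
  rewrite /= E3; split=> //; exists (fin, m1) => //.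
  by rewrite /fin; congr (Some (_, _)); lia.
have [|t [m2 [tT r2 I2]]] := Ic a m1 _ I1 P _ C1; first by lia.
have [i m' Hi||t' [m' [tT' r' I']]] := IH a.+1 m2 I2.
- by apply: Ic; lia.
- by lia.
exists (2 + (t + (1 + t'))), m'; split; [by lia| |].
- apply: (@reach_trans _ _ _ _ _ (pc + 3, m1)).
    rewrite /= E1; split; first by rewrite !geq_max S3 xS yS.
    exists (pc.+1, m1) => //; rewrite -addn1 /= E2; split=> //.
    exists (pc + 3, m1) => //.
    by rewrite /m1 /upd /= mx my; case: Z.ltb_spec => [//|H]; lia.
  apply: (reach_trans _ _ _ _ _ _ _ r2); apply: (@reach_trans _ _ _ _ _ (pc, m2)) r'.
  by rewrite /= E4; split=> //; exists (pc, m2).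
- by move: I'; rewrite (_ : maxn a.+1 b = maxn a b) //; lia.
Qed.

(** * Rules for single instructions and frame conditions *)

Lemma upd_same m d z : upd m d z d = z.
Proof. by rewrite /upd eqxx. Qed.

Lemma upd_other m d z x : x != d -> upd m d z x = m x.
Proof. by rewrite /upd => /negbTE ->. Qed.

Lemma wp_const d z s T S Q m : d <= S ->
  wp (Block s) T S Q (upd m d z) -> wp (Block (IConst d z :: s)) T.+1 S Q m.
Proof. by move=> dS H; apply: wp_cons. Qed.

Lemma wp_add d a b x y s T S Q m : m a = x -> m b = y -> maxn d (maxn a b) <= S ->
  wp (Block s) T S Q (upd m d (x + y)%Z) -> wp (Block (IAdd d a b :: s)) T.+1 S Q m.
Proof. by move=> <- <- dS H; apply: wp_cons. Qed.

Lemma wp_sub d a b x y s T S Q m : m a = x -> m b = y -> maxn d (maxn a b) <= S ->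
  wp (Block s) T S Q (upd m d (x - y)%Z) -> wp (Block (ISub d a b :: s)) T.+1 S Q m.
Proof. by move=> <- <- dS H; apply: wp_cons. Qed.

Lemma wp_mul d a b x y s T S Q m : m a = x -> m b = y -> maxn d (maxn a b) <= S ->
  wp (Block s) T S Q (upd m d (x * y)%Z) -> wp (Block (IMul d a b :: s)) T.+1 S Q m.
Proof. by move=> <- <- dS H; apply: wp_cons. Qed.

Lemma wp_div d a b x y s T S Q m : m a = x -> m b = y -> maxn d (maxn a b) <= S ->
  wp (Block s) T S Q (upd m d (x / y)%Z) -> wp (Block (IDiv d a b :: s)) T.+1 S Q m.
Proof. by move=> <- <- dS H; apply: wp_cons. Qed.

Lemma wp_load d a i z s T S Q m : m a = Z.of_nat i -> m i = z ->
  maxn d (maxn a i) <= S ->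
  wp (Block s) T S Q (upd m d z) -> wp (Block (ILoad d a :: s)) T.+1 S Q m.
Proof.
move=> Ea Ei dS H; apply: wp_cons => //; first by rewrite /touch /= Ea Nat2Z.id.
by rewrite /effect /= Ea Nat2Z.id Ei.
Qed.

Lemma wp_store a r i z s T S Q m : m a = Z.of_nat i -> m r = z ->
  maxn a (maxn r i) <= S ->
  wp (Block s) T S Q (upd m i z) -> wp (Block (IStore a r :: s)) T.+1 S Q m.
Proof.
move=> Ea Er dS H; apply: wp_cons => //; first by rewrite /touch /= Ea Nat2Z.id.
by rewrite /effect /= Ea Nat2Z.id Er.
Qed.

(** The address is formed in register 3; the bound 32 keeps the cell that is read distinct from
    it. *)
Lemma wp_read x b i B j z s T S Q m : m b = Z.of_nat B -> m i = Z.of_nat j ->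
  32 <= B + j -> maxn (maxn 3 b) (maxn i (maxn x (B + j))) <= S -> m (B + j) = z ->
  wp (Block s) T S Q (upd (upd m 3 (Z.of_nat (B + j))) x z) ->
  wp (Block [:: IAdd 3 b i, ILoad x 3 & s]) T.+2 S Q m.
Proof.
move=> Eb Ei lo hi Ez H; apply: (wp_add _ _ _ _ _ _ _ _ _ _ Eb Ei); first by lia.
apply: (wp_load _ _ (B + j) z); rewrite ?upd_same ?upd_other //; try lia.
by rewrite -Nat2Z.inj_add.
Qed.

Lemma wp_write b i r B j z s T S Q m : m b = Z.of_nat B -> m i = Z.of_nat j ->
  m r = z -> r != 3 -> maxn (maxn 3 b) (maxn i (maxn r (B + j))) <= S ->
  wp (Block s) T S Q (upd (upd m 3 (Z.of_nat (B + j))) (B + j) z) ->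
  wp (Block [:: IAdd 3 b i, IStore 3 r & s]) T.+2 S Q m.
Proof.
move=> Eb Ei Er r3 hi H; apply: (wp_add _ _ _ _ _ _ _ _ _ _ Eb Ei); first by lia.
apply: (wp_store _ _ (B + j) z); rewrite ?upd_same ?upd_other //; try lia.
by rewrite -Nat2Z.inj_add.
Qed.

Lemma wp_time c T T' S Q m : wp c T S Q m -> T <= T' -> wp c T' S Q m.
Proof. by move=> H TT; apply: wp_weaken H TT _. Qed.

Definition agree (D : pred nat) (m m' : memory) : Prop :=
  forall x, ~~ D x -> m' x = m x.

Lemma agree_upd (D : pred nat) m m' d z : D d -> agree D m m' -> agree D m (upd m' d z).
Proof.
move=> Dd H x Dx; rewrite upd_other ?H //.
by apply: contraNneq Dx => ->.
Qed.

Lemma agree_trans (D D' : pred nat) m m1 m2 : (forall x, D' x -> D x) ->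
  agree D m m1 -> agree D' m1 m2 -> agree D m m2.
Proof.
move=> DD H1 H2 x Dx; rewrite H2 ?H1 //; apply: contra Dx; exact: DD.
Qed.

(** * The program *)

(* [bW], [bA], [bP], [bF] hold the base addresses 32n, 64n, 96n, 128n of four
   arrays: the input, the values of the prefixes of p, the powers of k, and f. *)
Local Notation rk := 0 (only parsing).
Local Notation rn := 1 (only parsing).
Local Notation cst1 := 2 (only parsing).
Local Notation tmp := 3 (only parsing).
Local Notation ri := 4 (only parsing).
Local Notation rv := 5 (only parsing).
Local Notation rx := 6 (only parsing).
Local Notation ry := 7 (only parsing).
Local Notation bW := 8 (only parsing).
Local Notation bA := 9 (only parsing).
Local Notation bP := 10 (only parsing).
Local Notation bF := 11 (only parsing).
Local Notation cst0 := 12 (only parsing).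
Local Notation rU := 13 (only parsing).
Local Notation rw := 14 (only parsing).
Local Notation rm := 15 (only parsing).
Local Notation rh := 16 (only parsing).
Local Notation rd := 17 (only parsing).
Local Notation aA := 18 (only parsing).
Local Notation rN := 19 (only parsing).
Local Notation racc := 20 (only parsing).
Local Notation re := 21 (only parsing).
Local Notation rhalf := 22 (only parsing).
Local Notation rj := 23 (only parsing).
Local Notation rs := 24 (only parsing).

(** On entry [rv] holds [N - j - |p|]; if it is negative, the final copy overlaps [p] and prefix
    values are compared. Otherwise [rx] becomes [N - 2j] and [ry] becomes [j - |p|], whose sign
    selects the exponent [N - j - max(|p|, j)]. *)
Definition coef_code : cmd :=
  If false rv
    (Seq (Block [:: ISub rv re rs;
                    IAdd tmp bP rv; ILoad rx tmp;
                    IAdd tmp bA rs; ILoad ry tmp; IMul rx rx ry;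
                    IAdd tmp bA rv; ILoad ry tmp; IAdd rx rx ry;
                    IAdd tmp bA re; ILoad ry tmp; ISub rx ry rx])
         (If true rx (Block [:: IConst rv 1]) (Block [:: IConst rv 0])))
    (Seq (Block [:: ISub rx rs rj; ISub ry rv rx])
    (Seq (If false ry (Block [::]) (Block [:: IAdd rv rx cst0]))
         (Block [:: IAdd tmp bP rv; ILoad rv tmp]))).

Definition border_step : cmd :=
  Seq (Block [:: ISub rs rN rj; ISub rv rs rm])
  (Seq coef_code
       (Block [:: IAdd tmp bF rj; ILoad rx tmp; IMul rv rv rx; ISub racc racc rv;
                  IAdd rj rj cst1])).

(** For [n >= 1] the arrays, with indices at most [n], start [32 * n] cells apart and clear of the
    working registers, all below 32. The last cell is [129 * n], hence the address bound used
    throughout. *)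
Record base (k n : nat) (m : memory) : Prop := Base {
  base_k : m rk = Z.of_nat k;
  base_n : m rn = Z.of_nat n;
  base_one : m cst1 = 1%Z;
  base_W : m bW = Z.of_nat (32 * n);
  base_A : m bA = Z.of_nat (64 * n);
  base_P : m bP = Z.of_nat (96 * n);
  base_F : m bF = Z.of_nat (128 * n);
  base_zero : m cst0 = 0%Z;
  base_pow : forall i, i <= n -> m (96 * n + i) = Z.of_nat (k ^ i)
}.

Record prefix_ok (k n : nat) (p : seq nat) (m : memory) : Prop := PrefixOk {
  prefix_size : m rm = Z.of_nat (size p);
  prefix_val : forall i, i <= size p ->
    m (64 * n + i) = Z.of_nat (digits_val k (take i p))
}.

Record counts_ok (k n : nat) (p : seq nat) (N : nat) (m : memory) : Prop := CountsOk {
  counts_N : m rN = Z.of_nat N;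
  counts_min : m re = Z.of_nat (minn N (size p));
  counts_half : m rhalf = Z.of_nat N./2.+1;
  counts_val : forall j, 0 < j < N ->
    m (128 * n + j) = Z.of_nat (unbordered_count k p j)
}.

Ltac look := repeat first [rewrite upd_same | rewrite upd_other; last by lia].
Ltac reg := look; first [eassumption | reflexivity].
Ltac arith := first [ eapply wp_add | eapply wp_sub | eapply wp_mul | eapply wp_div];
  [reg | reg | by lia | ].

(** * Computing the counts of unbordered words *)

Lemma wp_coef_code k n p N j m : 0 < n -> all (ltn^~ k) p ->
  base k n m -> prefix_ok k n p m -> counts_ok k n p N m ->
  0 < j -> j + j <= N -> N <= n -> size p <= n -> m rj = Z.of_nat j ->
  m rs = Z.of_nat (N - j) -> m rv = (Z.of_nat (N - j) - Z.of_nat (size p))%Z ->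
  wp coef_code 20 (129 * n)
    (fun m' => agree [in [:: 3; 5; 6; 7]] m m' /\ m' rv = Z.of_nat (coef k p N j)) m.
Proof.
move=> n0 kp [Ek En E1 EW EA EP EF E0 Hpow] [Em HA] [EN Ee Eh HF] j0 jN Nn pn Ej Es Ev.
eapply wp_time; [eapply wp_if; first lia | ].
- rewrite /taken Ev => /Z.ltb_spec0 lt.
  have sp : N - j < size p by lia.
  set e := minn N (size p) in Ee; set l := e - (N - j).
  apply: wp_seq.
  arith.
  eapply (wp_read _ _ _ (96 * n) l); [reg|look; lia|lia|lia|look; apply: Hpow; lia|].
  eapply (wp_read _ _ _ (64 * n) (N - j)); [reg|reg|lia|lia|look; apply: HA; lia|].
  arith.
  eapply (wp_read _ _ _ (64 * n) l); [reg|look; lia|lia|lia|look; apply: HA; lia|].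
  arith.
  eapply (wp_read _ _ _ (64 * n) e); [reg|reg|lia|lia|look; apply: HA; lia|].
  arith.
  apply: wp_nil.
  have Hcoef : coef k p N j = (digits_val k (take e p) ==
      digits_val k (take (N - j) p) * k ^ l + digits_val k (take l p)).
    rewrite /coef sp -/e -/l (overlap_digits_val k) //; lia.
  apply: wp_if; [by lia | |]; look; rewrite /taken; case: Z.eqb_spec => // E _;
    (apply: wp_const; first by lia); apply: wp_nil; (split; first by do !apply: agree_upd => //);
    look; rewrite Hcoef; case: eqP => //; nia.
- rewrite /taken Ev => /Z.ltb_spec0 ge.
  have sp : size p <= N - j by lia.
  apply: wp_seq.
  arith.
  arith.
  apply: wp_nil.
  apply: wp_seq.
  set m1 := upd _ 7 _.
  apply: (@wp_weaken _ _ _ _ (fun m' => agree [in [:: 3; 5; 6; 7]] m m' /\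
    m' rv = Z.of_nat (N - j - maxn (size p) j))).
  + apply: wp_if; [by lia | |]; rewrite /m1; look; rewrite /taken.
      move=> /Z.ltb_spec0 lt; apply: wp_nil; split; first by do !apply: agree_upd => //.
      by look; lia.
    move=> /Z.ltb_spec0 lt; arith; apply: wp_nil; split; first by do !apply: agree_upd => //.
    by look; lia.
  + exact: leqnn.
  move=> m2 [A2 V2].
  eapply (wp_read _ _ _ (96 * n)); [by rewrite A2|reg|lia|lia|rewrite A2; [apply: Hpow|]|].
  + by lia.
  + by rewrite !inE; lia.
  apply: wp_nil; split; first by do !apply: agree_upd => //.
  by look; rewrite /coef ltnNge sp.
- by [].
Qed.

(** This and the next two frame lemmas list cells whose preservation keeps each invariant. *)
Lemma base_agree (D : pred nat) k n m m' :
  (forall x, (x \in [:: 0; 1; 2; 8; 9; 10; 11; 12]) || (96 * n <= x <= 97 * n) -> ~~ D x) ->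
  agree D m m' -> base k n m -> base k n m'.
Proof.
move=> HD A [Ek En E1 EW EA EP EF E0 Hpow].
by split=> [||||||||i Hi]; rewrite A ?Hpow //; apply: HD => //; lia.
Qed.

Lemma prefix_agree (D : pred nat) k n p m m' :
  (forall x, (x == 15) || (64 * n <= x <= 64 * n + size p) -> ~~ D x) ->
  agree D m m' -> prefix_ok k n p m -> prefix_ok k n p m'.
Proof.
by move=> HD A [Em HA]; split=> [|i Hi]; rewrite A ?HA //; apply: HD; lia.
Qed.

Lemma counts_agree (D : pred nat) k n p N m m' :
  (forall x, (x \in [:: 19; 21; 22]) || (128 * n <= x) -> ~~ D x) ->
  agree D m m' -> counts_ok k n p N m -> counts_ok k n p N m'.
Proof.
move=> HD A [EN Ee Eh HF].
by split=> [|||i Hi]; rewrite A ?HF //; apply: HD => //; lia.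
Qed.

Lemma Z_half N : (Z.of_nat N / 2)%Z = Z.of_nat N./2.
Proof. by rewrite -divn2; Z.to_euclidean_division_equations; lia. Qed.

Lemma agree_sub (D D' : pred nat) m m' : (forall x, D' x -> D x) ->
  agree D' m m' -> agree D m m'.
Proof. by move=> DD H x Dx; apply: H; apply: contra Dx; exact: DD. Qed.

(** One sign test yields both the minimum of [N] and [|p|] in [re] and the truncated difference
    [N - |p|] in [rv], the exponent in the recurrence. *)
Definition count_step : cmd :=
  Seq (Block [:: IAdd rN rN cst1; ISub rv rN rm])
  (Seq (If false rv (Block [:: IAdd re rN cst0; IConst rv 0]) (Block [:: IAdd re rm cst0]))
  (Seq (Block [:: IAdd tmp bP rv; ILoad racc tmp; IConst rv 2; IDiv rhalf rN rv;
                  IAdd rhalf rhalf cst1; IConst rj 1])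
  (Seq (WhileLt rj rhalf border_step)
       (Block [:: IAdd tmp bF rN; IStore tmp racc])))).

Lemma wp_border_step k n p N j a m : 0 < n -> all (ltn^~ k) p ->
  base k n m -> prefix_ok k n p m -> counts_ok k n p N m ->
  0 < j -> j + j <= N -> N <= n -> size p <= n -> m rj = Z.of_nat j -> m racc = a ->
  wp border_step 30 (129 * n)
    (fun m' => [/\ agree [in [:: 3; 5; 6; 7; 20; 23; 24]] m m',
       m' rj = Z.of_nat j.+1 &
       m' racc = (a - Z.of_nat (unbordered_count k p j * coef k p N j))%Z]) m.
Proof.
move=> n0 kp Hb Hp Hc j0 jN Nn pn Ej Ea.
have [_ _ E1 _ _ _ EF _ _] := Hb; have [Em _] := Hp; have [EN _ _ HF] := Hc.
eapply wp_time; [apply: wp_seq; arith; arith; apply: wp_nil; apply: wp_seq|].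
  set m1 := upd _ 5 _.
  have A1 : agree [in [:: 5; 24]] m m1 by do !apply: agree_upd => //.
  apply: (wp_weaken _ _ _ _ _ _ _ (wp_coef_code k n p N j m1 _ _ _ _ _ _ _ _ _ _ _ _)) => //.
  - by apply: base_agree A1 Hb => x; rewrite /= !inE; lia.
  - by apply: prefix_agree A1 Hp => x; rewrite /= !inE; lia.
  - by apply: counts_agree A1 Hc => x; rewrite /= !inE; lia.
  - by rewrite /m1; look; lia.
  - by rewrite /m1; look; lia.
  move=> m2 [A2 V2].
  have A : agree [in [:: 3; 5; 6; 7; 24]] m m2.
    apply: agree_trans A2; first by move=> x; rewrite /= !inE; lia.
    by apply: agree_sub A1 => x; rewrite /= !inE; lia.
  eapply (wp_read _ _ _ (128 * n) j); [by rewrite A|by rewrite A|by lia|by lia| |].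
    by rewrite A; [apply: HF; lia|rewrite /= !inE; lia].
  have E2 : m2 20 = a by rewrite A.
  have E3 : m2 23 = Z.of_nat j by rewrite A.
  have E4 : m2 2 = 1%Z by rewrite A.
  arith. arith. arith.
  apply: wp_nil; split; [|by look; lia|by look; lia].
  do !apply: agree_upd => //; apply: agree_sub A => x; rewrite /= !inE; lia.
by [].
Qed.

(** There are at most [n / 2] border lengths, each costing at most 30 steps plus 3 for the loop, so
    the cost is linear. *)
Lemma wp_count_step k n p N m : 0 < n -> all (ltn^~ k) p ->
  base k n m -> prefix_ok k n p m -> N < n -> size p <= n -> m rN = Z.of_nat N ->
  (forall j, 0 < j <= N -> m (128 * n + j) = Z.of_nat (unbordered_count k p j)) ->
  wp count_step (60 * n) (129 * n)
    (fun m' => [/\ agree (fun x => (x \in [:: 3; 5; 6; 7; 19; 20; 21; 22; 23; 24])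
                                 || (128 * n <= x)) m m',
       m' rN = Z.of_nat N.+1 &
       forall j, 0 < j <= N.+1 ->
         m' (128 * n + j) = Z.of_nat (unbordered_count k p j)]) m.
Proof.
move=> n0 kp Hb Hp Nn pn EN HF.
have [_ _ E1 _ _ EP EF E0 Hpow] := Hb; have [Em _] := Hp.
eapply wp_time; [apply: wp_seq; arith; arith; apply: wp_nil; apply: wp_seq|].
  set m1 := upd _ 5 _.
  apply: (@wp_weaken _ _ _ _ (fun m' => [/\ agree [in [:: 5; 19; 21]] m m',
     m' rN = Z.of_nat N.+1, m' re = Z.of_nat (minn N.+1 (size p)) &
     m' rv = Z.of_nat (N.+1 - size p)])).
  - apply: wp_if; [by lia | |]; rewrite /m1; look; rewrite /taken => /Z.ltb_spec0 lt.
      arith; apply: wp_const; first by lia.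
      by apply: wp_nil; split; [by do !apply: agree_upd => //| | |]; look; lia.
    by arith; apply: wp_nil; split; [by do !apply: agree_upd => //| | |]; look; lia.
  - exact: leqnn.
  move=> m2 [A2 N2 e2 v2].
  apply: wp_seq.
  eapply (wp_read _ _ _ (96 * n) (N.+1 - size p)); [by rewrite A2|reg|lia|lia| |].
    by rewrite A2; [apply: Hpow; lia|rewrite /= !inE; lia].
  have E2 : m2 2 = 1%Z by rewrite A2.
  apply: wp_const; first by lia.
  arith. arith. apply: wp_const; first by lia.
  apply: wp_nil; apply: wp_seq.
  set m3 := upd _ 23 _.
  have A3 : agree [in [:: 3; 5; 19; 20; 21; 22; 23]] m m3.
    by do !apply: agree_upd => //; apply: agree_sub A2 => x; rewrite /= !inE; lia.
  have B3 : base k n m3 by apply: base_agree A3 Hb => x; rewrite /= !inE; lia.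
  have P3 : prefix_ok k n p m3 by apply: prefix_agree A3 Hp => x; rewrite /= !inE; lia.
  have C3 : counts_ok k n p N.+1 m3.
    split; rewrite /m3; look=> //; first by rewrite Z_half; lia.
    by move=> j Hj; rewrite -/m3 A3 ?HF //= ?inE; lia.
  (* The accumulator starts at the power of [k] and sheds one term of the recurrence per round, in
     [Z] and hence without truncation. *)
  set J := fun j (m' : memory) =>
    [/\ agree [in [:: 3; 5; 6; 7; 20; 23; 24]] m3 m', m' rj = Z.of_nat j &
     m' racc = (Z.of_nat (k ^ (N.+1 - size p)) - Z.of_nat
       (\sum_(1 <= i < j) unbordered_count k p i * coef k p N.+1 i))%Z].
  apply: (wp_weaken _ _ _ _ _ _ _ (wp_while J _ _ _ 1 N.+1./2.+1 30 _ _ _ _ _ _ _ _ _));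
    try by lia.
  - by move=> i m' [A' -> _]; rewrite A' //; split=> //; case: C3.
  - by move=> i m' z [A' j' acc']; split; [exact: agree_upd| |]; look.
  - move=> j m' Hj [A' j' acc'].
    apply: (wp_weaken _ _ _ _ _ _ _ (wp_border_step k n p N.+1 j _ m' _ _ _ _ _ _ _ _ _ _ acc'));
      try by lia.
    + by apply: base_agree A' B3 => x; rewrite /= !inE; lia.
    + by apply: prefix_agree A' P3 => x; rewrite /= !inE; lia.
    + by apply: counts_agree A' C3 => x; rewrite /= !inE; lia.
    move=> m4 [A4 j4 acc4]; split=> //; first by apply: agree_trans A' A4.
    by rewrite acc4 big_nat_recr /=; lia.
  - by split=> //; rewrite /m3; look=> //; rewrite big_geq //; lia.
  - exact: leqnn.
  have -> : maxn 1 N.+1./2.+1 = N.+1./2.+1 by lia.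
  move=> m4 [A4 j4 acc4].
  have F4 : m4 bF = Z.of_nat (128 * n) by rewrite A4 //; case: B3.
  have N4 : m4 rN = Z.of_nat N.+1 by rewrite A4 //; case: C3.
  eapply (wp_write _ _ _ (128 * n) N.+1); [reg|reg|reg|by []|by lia|].
  apply: wp_nil; split; last 1 first.
  - move=> j Hj; case: (eqVneq j N.+1) => [->|jN].
      (* The new entry is the final accumulator, which the recurrence identifies with the count. *)
      rewrite upd_same; have := unbordered_count_rec k p N.+1 kp; lia.
    look; rewrite A4 ?A3 ?HF //= ?inE; lia.
  - apply: agree_upd => //=; first by lia.
    apply: agree_upd => //; move=> x Hx; rewrite A4 ?A3 //; move: Hx; rewrite /= !inE; lia.
  - by look.
by lia.
Qed.

(** * The loops over digits and letters *)

Definition digit_step : cmd :=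
  Seq (Block [:: IAdd rv rh rd; IStore aA rv; IConst rN 0])
  (Seq (WhileLt rN rn count_step)
       (Block [:: IAdd tmp bF rn; ILoad rv tmp; IAdd rU rU rv; IAdd rd rd cst1])).

Lemma take_rcons_take (u : seq nat) i j d : j <= i -> i < size u ->
  take j (rcons (take i u) d) = take j u.
Proof.
by move=> ji iu; rewrite -cats1 takel_cat ?take_takel // size_takel // ltnW.
Qed.

(** The prefixes of [p] are those of [u] up to length [i] and [p] itself, so a single prefix value
    has to be stored for each [d]. The counts are rebuilt from [N = 0] for every digit. *)
Lemma wp_digit_step k n u i d U m : 0 < n -> all (ltn^~ k) u -> size u = n ->
  i < n -> d < nth 0 u i -> base k n m ->
  m rm = Z.of_nat i.+1 -> m rh = Z.of_nat (digits_val k (take i u) * k) ->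
  m rd = Z.of_nat d -> m aA = Z.of_nat (64 * n + i.+1) -> m rU = U ->
  (forall j, j <= i -> m (64 * n + j) = Z.of_nat (digits_val k (take j u))) ->
  wp digit_step (80 * n * n) (129 * n)
    (fun m' => [/\ agree (fun x => (x \in [:: 3; 5; 6; 7; 13; 17; 19; 20; 21; 22; 23; 24])
                                 || (x == 64 * n + i.+1) || (128 * n <= x)) m m',
       m' rd = Z.of_nat d.+1 &
       m' rU = (U + Z.of_nat (unbordered_count k (rcons (take i u) d) n))%Z]) m.
Proof.
move=> n0 ku su ni du Hb Em Eh Ed EA EU HA.
have [_ _ E1 _ _ _ _ _ _] := Hb.
set p := rcons (take i u) d.
have sp : size p = i.+1 by rewrite size_rcons size_takel // su ltnW.
have kp : all (ltn^~ k) p.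
  rewrite all_rcons all_take // andbT; apply: ltn_trans du _.
  by apply: (allP ku); rewrite mem_nth ?su.
eapply wp_time; [apply: wp_seq; arith|].
  eapply wp_store; [reg|reg|by lia|].
  apply: wp_const; first by lia.
  apply: wp_nil; apply: wp_seq.
  set m1 := upd _ 19 _.
  have A1 : agree (fun x => (x \in [:: 5; 19]) || (x == 64 * n + i.+1)) m m1.
    by do !apply: agree_upd => //=; lia.
  have B1 : base k n m1 by apply: base_agree A1 Hb => x; rewrite !inE; lia.
  have P1 : prefix_ok k n p m1.
    split; first by rewrite A1 ?sp // !inE; lia.
    rewrite sp => j ji; case: (eqVneq j i.+1) => [->|nj].
      by rewrite /m1; look; rewrite -sp take_size /p digits_val_rcons; lia.
    by rewrite A1 ?HA ?take_rcons_take ?su ?inE //; lia.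
  set J := fun N (m' : memory) =>
    [/\ agree (fun x => (x \in [:: 3; 5; 6; 7; 19; 20; 21; 22; 23; 24])
                        || (128 * n <= x)) m1 m', m' rN = Z.of_nat N &
     forall j, 0 < j <= N -> m' (128 * n + j) = Z.of_nat (unbordered_count k p j)].
  apply: (wp_weaken _ _ _ _ _ _ _ (wp_while J _ _ _ 0 n (60 * n) _ _ _ _ _ _ _ _ _));
    try by lia.
  - move=> N m' [A' -> _]; rewrite A'; last by rewrite !inE; lia.
    by split=> //; case: B1.
  - move=> N m' z [A' N' F']; split; [exact: agree_upd|by look|].
    by move=> j Hj; look; exact: F'.
  - move=> N m' HN [A' N' F'].
    apply: (wp_weaken _ _ _ _ _ _ _ (wp_count_step k n p N m' _ _ _ _ _ _ _ _));
      try by lia.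
    + by apply: base_agree A' B1 => x; rewrite !inE; lia.
    + by apply: prefix_agree A' P1 => x; rewrite ?sp !inE; lia.
    + by [].
    move=> m4 [A4 N4 F4]; split=> //; exact: agree_trans A' A4.
  (* The entries start at index 1, so none is required when [N = 0]. *)
  - by split=> // j; lia.
  - exact: leqnn.
  rewrite max0n => m2 [A2 N2 F2].
  have n2 : m2 1 = Z.of_nat n by rewrite A2 ?inE; [case: B1|lia].
  have b2 : m2 11 = Z.of_nat (128 * n) by rewrite A2 ?inE; [case: B1|lia].
  have U2 : m2 13 = U by rewrite A2 ?A1 ?inE //; lia.
  have d2 : m2 17 = Z.of_nat d by rewrite A2 ?A1 ?inE //; lia.
  have o2 : m2 2 = 1%Z by rewrite A2 ?A1 ?inE //; lia.
  eapply (wp_read _ _ _ (128 * n) n); [reg|reg|by lia|by lia|by apply: F2; lia|].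
  arith. arith. apply: wp_nil; split; [|by look; lia|by look].
  do !apply: agree_upd => //.
  by move=> x Hx; rewrite A2 ?A1 //; move: Hx; rewrite !inE; lia.
by nia.
Qed.

(** The first subtraction turns a letter into a digit. After the digit loop, the cell of the prefix
    of length [i + 1] receives the value for the true letter of [u], ready for the next [i]. *)
Definition letter_step : cmd :=
  Seq (Block [:: IAdd tmp bW ri; ILoad rw tmp; ISub rw rw cst1; IAdd rm ri cst1;
                 IAdd tmp bA ri; ILoad rh tmp; IMul rh rh rk; IConst rd 0;
                 IAdd aA bA rm])
  (Seq (WhileLt rd rw digit_step)
       (Block [:: IAdd rv rh rw; IStore aA rv; IAdd ri ri cst1])).

Record letters_ok (k n : nat) (u : seq nat) (i : nat) (m : memory) : Prop := LettersOk {
  letters_base : base k n m;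
  letters_input : forall j, j < n -> m (32 * n + j) = Z.of_nat (nth 0 u j).+1;
  letters_val : forall j, j <= i -> m (64 * n + j) = Z.of_nat (digits_val k (take j u));
  letters_i : m ri = Z.of_nat i;
  letters_total : m rU = Z.of_nat (\sum_(0 <= j < i) \sum_(0 <= d < nth 0 u j)
                                     unbordered_count k (rcons (take j u) d) n)
}.

Lemma wp_letter_step k n u i m : 0 < n -> all (ltn^~ k) u -> size u = n -> i < n ->
  letters_ok k n u i m ->
  wp letter_step (100 * k * n * n) (129 * n) (letters_ok k n u i.+1) m.
Proof.
move=> n0 ku su ni [Hb HW HA Ei EU].
have [Ek En E1 EW EA EP EF E0 Hpow] := Hb.
have uk : nth 0 u i < k by apply: (allP ku); rewrite mem_nth ?su.
set U := Z.of_nat _ in EU.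
eapply wp_time; [apply: wp_seq|].
  eapply (wp_read _ _ _ (32 * n) i); [reg|reg|by lia|by lia|by apply: HW; lia|].
  arith. arith.
  eapply (wp_read _ _ _ (64 * n) i); [reg|reg|by lia|by lia|by look; apply: HA; lia|].
  arith. apply: wp_const; first by lia.
  arith. apply: wp_nil; apply: wp_seq.
  set m1 := upd _ 18 _.
  have A1 : agree [in [:: 3; 14; 15; 16; 17; 18]] m m1 by do !apply: agree_upd => //.
  have B1 : base k n m1 by apply: base_agree A1 Hb => x; rewrite /= !inE; lia.
  have w1 : m1 rw = Z.of_nat (nth 0 u i) by rewrite /m1; look; lia.
  set D := fun x => (x \in [:: 3; 5; 6; 7; 13; 17; 19; 20; 21; 22; 23; 24])
                    || (x == 64 * n + i.+1) || (128 * n <= x).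
  have h1 : m1 rh = Z.of_nat (digits_val k (take i u) * k) by rewrite /m1; look; lia.
  have a1 : m1 aA = Z.of_nat (64 * n + i.+1) by rewrite /m1; look; lia.
  have V1 j : j <= i -> m1 (64 * n + j) = Z.of_nat (digits_val k (take j u)).
    by move=> ji; rewrite A1 ?HA //= !inE; lia.
  set J := fun d (m' : memory) =>
    [/\ agree D m1 m', m' rd = Z.of_nat d &
     m' rU = (U + Z.of_nat (\sum_(0 <= d' < d)
                              unbordered_count k (rcons (take i u) d') n))%Z].
  apply: (wp_weaken _ _ _ _ _ _ _
    (wp_while J _ _ _ 0 (nth 0 u i) (80 * n * n) _ _ _ _ _ _ _ _ _)); try by lia.
  - by move=> d m' [A' -> _]; rewrite A' // /D !inE; lia.
  - by move=> d m' z [A' d' U']; split; [exact: agree_upd|look|look].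
  - move=> d m' Hd [A' d' U'].
    apply: (wp_weaken _ _ _ _ _ _ _
      (wp_digit_step k n u i d _ m' _ _ _ _ _ _ _ _ _ _ U' _)); try by lia.
    + by apply: base_agree A' B1 => x; rewrite /D !inE; lia.
    + by rewrite A' /D ?inE; [rewrite /m1; look; lia|lia].
    + by rewrite A' // /D ?inE; lia.
    + by rewrite A' // /D ?inE; lia.
    + by move=> j ji; rewrite A' ?V1 // /D !inE; lia.
    move=> m4 [A4 d4 U4]; split=> //; first exact: agree_trans A' A4.
    by rewrite U4 big_nat_recr //=; lia.
  - split=> //; rewrite /m1; look=> //; rewrite big_geq // EU; lia.
  - exact: leqnn.
  rewrite max0n => m2 [A2 d2 U2].
  have w2 : m2 rw = Z.of_nat (nth 0 u i) by rewrite A2 // /D !inE; lia.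
  have h2 : m2 rh = Z.of_nat (digits_val k (take i u) * k) by rewrite A2 // /D !inE; lia.
  have a2 : m2 aA = Z.of_nat (64 * n + i.+1) by rewrite A2 // /D !inE; lia.
  have i2 : m2 ri = Z.of_nat i by rewrite A2 ?A1 // /D !inE; lia.
  have o2 : m2 cst1 = 1%Z by rewrite A2 ?A1 // /D !inE; lia.
  arith. eapply wp_store; [reg|reg|by lia|]. arith. apply: wp_nil.
  split.
  - apply: (@base_agree (fun x => D x || (x == 4)) k n m1) B1.
      by move=> x; rewrite /D !inE; lia.
    do !apply: agree_upd; rewrite /D ?inE; try lia.
    by apply: agree_sub A2 => x; rewrite /D => ->.
  - by move=> j jn; look; rewrite A2 ?A1 ?HW // /D ?inE /= ?inE; lia.
  - move=> j ji; case: (eqVneq j i.+1) => [->|nj].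
      by look; rewrite (take_nth 0) ?su // digits_val_rcons; lia.
    by look; rewrite A2 ?V1 // /D ?inE; lia.
  - by look; lia.
  - by look; rewrite U2 big_nat_recr //= /U; lia.
(* At most [k] digits are tried at each position; lower-order costs are absorbed using
   [k <= k * (n * n)]. *)
have H1 : nth 0 u i * (80 * n * n + 3) <= k * (80 * n * n + 3) by rewrite leq_mul // ltnW.
have H2 : k <= k * (n * n) by rewrite leq_pmulr // muln_gt0 n0.
rewrite subn0 -!mulnA in H1 *; move: H1 H2 uk; rewrite mulnDr.
by move: (n * n) => q; nia.
Qed.

(** * Setting up the memory layout *)

(* The input occupies the registers used as scratch space, so the first seven
   letters have to be moved to address 32n, computed by doublings in register 1,
   before a copying loop can be run. *)
Definition relocate : cmd :=
  Seq (Block [:: IAdd 1 1 1; IAdd 1 1 1; IAdd 1 1 1; IAdd 1 1 1; IAdd 1 1 1;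
                 IStore 1 2; IConst 2 1; IAdd 1 1 2; IStore 1 3; IAdd 1 1 2; IStore 1 4;
                 IAdd 1 1 2; IStore 1 5; IAdd 1 1 2; IStore 1 6; IAdd 1 1 2; IStore 1 7;
                 IAdd 1 1 2; IStore 1 8;
                 IConst tmp 6; ISub bW 1 tmp; IConst tmp 32; IDiv rn bW tmp; IConst ri 7])
      (WhileLt ri rn
        (Block [:: IAdd rv ri cst1; IAdd rv rv cst1; ILoad rx rv;
                   IAdd tmp bW ri; IStore tmp rx; IAdd ri ri cst1])).

Record relocated (k n : nat) (u : seq nat) (m : memory) : Prop := Relocated {
  relocated_k : m rk = Z.of_nat k;
  relocated_n : m rn = Z.of_nat n;
  relocated_one : m cst1 = 1%Z;
  relocated_W : m bW = Z.of_nat (32 * n);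
  relocated_input : forall j, j < n -> m (32 * n + j) = Z.of_nat (nth 0 u j).+1
}.

(** The length is recovered as [32 n / 32]. For [n < 7] the fixed moves also copy cells past the
    input, but only entries [j < n] are claimed. *)
Lemma wp_relocate k n u : 0 < n -> size u = n ->
  wp relocate (50 * n) (129 * n) (relocated k n u) (init_mem k [seq x.+1 | x <- u]).
Proof.
move=> n0 su; set m := init_mem _ _.
have m0 : m 0 = Z.of_nat k by [].
have m1 : m 1 = Z.of_nat n by rewrite /m /= size_map su.
have mW j : j < n -> m (j + 2) = Z.of_nat (nth 0 u j).+1.
  by move=> jn; rewrite addn2 /m /= size_map su jn (nth_map 0) // su.
eapply wp_time; [apply: wp_seq|].
  do 5 arith.
  eapply (wp_store _ _ (32 * n + 0)); [by look; lia|reg|by lia|].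
  apply: wp_const; first by lia.
  arith; eapply (wp_store _ _ (32 * n + 1)); [by look; lia|reg|by lia|].
  arith; eapply (wp_store _ _ (32 * n + 2)); [by look; lia|reg|by lia|].
  arith; eapply (wp_store _ _ (32 * n + 3)); [by look; lia|reg|by lia|].
  arith; eapply (wp_store _ _ (32 * n + 4)); [by look; lia|reg|by lia|].
  arith; eapply (wp_store _ _ (32 * n + 5)); [by look; lia|reg|by lia|].
  arith; eapply (wp_store _ _ (32 * n + 6)); [by look; lia|reg|by lia|].
  apply: wp_const; first by lia.
  arith.
  apply: wp_const; first by lia.
  arith.
  apply: wp_const; first by lia.
  apply: wp_nil.
  (* Letters not yet copied still sit at [j + 2]; the bound [7 <= i] keeps them above the registers
     in use, which end at 8. *)
  set J := fun i (m' : memory) => [/\ m' 0 = Z.of_nat k /\ m' 1 = Z.of_nat n, m' 2 = 1%Z,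
    m' 8 = Z.of_nat (32 * n), 7 <= i /\ m' 4 = Z.of_nat i &
    (forall j, j < n -> j < i -> m' (32 * n + j) = Z.of_nat (nth 0 u j).+1) /\
    (forall j, i <= j -> j < n -> m' (j + 2) = Z.of_nat (nth 0 u j).+1)].
  apply: (wp_weaken _ _ _ _ _ _ _ (wp_while J _ _ _ 7 n 6 _ _ _ _ _ _ _ _ _)); try by lia.
  - by move=> i m' [[_ ->] _ _ [_ ->] _].
  - move=> i m' z [[k' n'] o' b' [i7 i'] [d' s']].
    by split; rewrite /=; look=> //; split=> // j Hj Hj'; look; auto.
  - move=> i m' Hi [[k' n'] o' b' [i7 i'] [d' s']].
    arith. arith.
    eapply (wp_load _ _ (i + 2)); [by look; lia|by look; apply: s'; lia|by lia|].
    eapply (wp_write _ _ _ (32 * n) i); [reg|reg|reg|by []|by lia|].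
    arith. apply: wp_nil; split; look=> //; split=> //; try lia.
      move=> j jn ji; case: (eqVneq j i) => [->|nj]; look=> //.
      by apply: d' => //; lia.
    by move=> j ij jn; look; apply: s' => //; lia.
  - split; [split| | |split|split].
    + by look; exact: m0.
    + by look; Z.to_euclidean_division_equations; lia.
    + by look; reflexivity.
    + by look; lia.
    + by [].
    + by look; reflexivity.
    + by do 7! (case; first by move=> jn _; look; exact: (mW _ jn)).
    + by move=> j j7 jn; look; exact: mW.
  - exact: leqnn.
  by move=> m' [[? ?] ? ? [_ _] [d' _]]; split=> // j jn; apply: d' => //; lia.
by lia.
Qed.

(** The 0 stored through [bA] is the value of the empty prefix. *)
Definition powers : cmd :=
  Seq (Block [:: IAdd bA bW bW; IAdd bP bA bW; IAdd bF bP bW; IConst cst0 0;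
                 IStore bA cst0; IStore bP cst1; IConst ri 0])
      (WhileLt ri rn
        (Block [:: IAdd tmp bP ri; ILoad rv tmp; IMul rv rv rk; IAdd ri ri cst1;
                   IAdd tmp bP ri; IStore tmp rv])).

Lemma wp_powers k n u m : 0 < n -> relocated k n u m ->
  wp powers (30 * n) (129 * n) (fun m' => [/\ base k n m',
    forall j, j < n -> m' (32 * n + j) = Z.of_nat (nth 0 u j).+1 & m' (64 * n) = 0%Z]) m.
Proof.
move=> n0 [Ek En E1 EW HW].
eapply wp_time; [apply: wp_seq|].
  do 3 arith.
  apply: wp_const; first by lia.
  eapply (wp_store _ _ (64 * n)); [by look; lia|reg|by lia|].
  eapply (wp_store _ _ (96 * n)); [by look; lia|reg|by lia|].
  apply: wp_const; first by lia.
  apply: wp_nil.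
  set m1 := upd _ 4 _.
  set J := fun i (m' : memory) =>
    [/\ agree (fun x => (x \in [:: 3; 4; 5]) || (96 * n < x)) m1 m', m' 4 = Z.of_nat i &
     forall j, j <= i -> m' (96 * n + j) = Z.of_nat (k ^ j)].
  have k1 : m1 0 = Z.of_nat k by rewrite /m1; look.
  have n1 : m1 1 = Z.of_nat n by rewrite /m1; look.
  have o1 : m1 2 = 1%Z by rewrite /m1; look.
  have w1 : m1 8 = Z.of_nat (32 * n) by rewrite /m1; look.
  have a1 : m1 9 = Z.of_nat (64 * n) by rewrite /m1; look; lia.
  have p1 : m1 10 = Z.of_nat (96 * n) by rewrite /m1; look; lia.
  have f1 : m1 11 = Z.of_nat (128 * n) by rewrite /m1; look; lia.
  have z1 : m1 12 = 0%Z by rewrite /m1; look.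
  apply: (wp_weaken _ _ _ _ _ _ _ (wp_while J _ _ _ 0 n 6 _ _ _ _ _ _ _ _ _)); try by lia.
  - by move=> i m' [A' -> _]; rewrite A' // !inE; lia.
  - move=> i m' z [A' i' P']; split; [exact: agree_upd|by look|].
    by move=> j ji; look; exact: P'.
  - move=> i m' Hi [A' i' P'].
    have k2 : m' 0 = Z.of_nat k by rewrite A' // !inE; lia.
    have o2 : m' 2 = 1%Z by rewrite A' // !inE; lia.
    have p2 : m' 10 = Z.of_nat (96 * n) by rewrite A' // !inE; lia.
    eapply (wp_read _ _ _ (96 * n) i); [reg|reg|by lia|by lia|by apply: P'|].
    arith. arith.
    eapply (wp_write _ _ _ (96 * n) i.+1); [reg|by look; lia|reg|by []|by lia|].
    apply: wp_nil; split; [|by look; lia|].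
      by do !apply: agree_upd => //; rewrite !inE; lia.
    move=> j ji; case: (eqVneq j i.+1) => [->|nj]; look; last by apply: P'; lia.
    by rewrite expnSr; lia.
  - split=> //.
    by move=> j; rewrite leqn0 => /eqP ->; rewrite addn0 /m1; look.
  - exact: leqnn.
  rewrite max0n => m2 [A2 _ P2].
  split; last 2 first.
  - by move=> j jn; rewrite A2 ?inE; [rewrite /m1; look; exact: HW|lia].
  - by rewrite A2 ?inE; [rewrite /m1; look|lia].
  - by split; rewrite ?A2 // ?inE; lia.
by lia.
Qed.

(** * The whole program and its cost *)

Definition rank_code : cmd :=
  Seq relocate
  (Seq powers
  (Seq (Block [:: IConst rU 0; IConst ri 0])
  (Seq (WhileLt ri rn letter_step)
       (Block [:: IAdd tmp bA rn; ILoad rv tmp; ISub rv rv rU; IAdd rk rv cst1])))).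

(** After the last letter, entry [n] of the prefix values is the value of [u]; by [rankB_succ] the
    rank is this minus the accumulated total, plus 1. *)
Lemma wp_rank_code k n u : 0 < n -> 0 < k -> size u = n -> all (ltn^~ k) u ->
  wp rank_code (300 * k * n ^ 3) (129 * n)
    (fun m => m 0 = Z.of_nat (rankB k [seq x.+1 | x <- u])) (init_mem k [seq x.+1 | x <- u]).
Proof.
move=> n0 k0 su ku.
eapply wp_time; [apply: wp_seq|].
  apply: (wp_weaken _ _ _ _ _ _ _ (wp_relocate k n u n0 su) (leqnn _)) => m1 R1.
  apply: wp_seq.
  apply: (wp_weaken _ _ _ _ _ _ _ (wp_powers k n u m1 n0 R1) (leqnn _)) => m2 [B2 W2 A2].
  apply: wp_seq.
  apply: wp_const; first by lia.
  apply: wp_const; first by lia.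
  apply: wp_nil; apply: wp_seq.
  set m3 := upd _ 4 _.
  have A3 : agree [in [:: 4; 13]] m2 m3 by do !apply: agree_upd => //.
  apply: (wp_weaken _ _ _ _ _ _ _ (wp_while (letters_ok k n u)
    _ _ _ 0 n (100 * k * n * n) _ _ _ _ _ _ _ _ _)); try by lia.
  - by move=> i m' [[]].
  - move=> i m' z [Hb HW HA Ei EU]; split.
    + apply: (@base_agree [in [:: 3]] k n m') Hb; first by move=> x; rewrite /= !inE; lia.
      exact: agree_upd.
    + by move=> j jn; look; exact: HW.
    + by move=> j ji; look; exact: HA.
    + by look.
    + by look.
  - by move=> i m' Hi L'; apply: wp_letter_step => //; lia.
  - split.
    + by apply: base_agree A3 B2 => x; rewrite /= !inE; lia.
    + by move=> j jn; rewrite A3 ?W2 //= !inE; lia.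
    + by move=> j; rewrite leqn0 => /eqP ->; rewrite take0 addn0 A3 //= !inE; lia.
    + by rewrite /m3; look.
    + by rewrite /m3; look; rewrite big_geq.
  - exact: leqnn.
  rewrite max0n => m4 [[Ek En E1 EW EA EP EF E0 Hpow] HW HA Ei EU].
  eapply (wp_read _ _ _ (64 * n) n); [reg|reg|by lia|by lia|by apply: HA|].
  arith. arith. apply: wp_nil; look.
  have tu : take n u = u by rewrite -su take_size.
  by have := rankB_succ k u ku; rewrite su tu; lia.
(* Set-up and loop overheads are linear in [n], and are absorbed by [n <= n ^ 3 <= k * n ^ 3]. *)
have n3 : n * n <= n ^ 3 by rewrite !expnS muln1; nia.
have n1 : n <= n ^ 3 by nia.
have kn : n ^ 3 <= k * n ^ 3 by rewrite leq_pmull.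
have E : (n - 0) * (100 * k * n * n + 3) = 100 * (k * n ^ 3) + 3 * n.
  by rewrite !expnS muln1; nia.
by rewrite E -mulnA; lia.
Qed.

(* There is a single unit-cost RAM program P and a constant C such that for
   all n >= 1, k >= 2 and all w in Sigma_k^n, P started on (k, w) halts after
   t <= C*k*n^3 steps with output rankB_k(w), having used at most C*n
   registers. *)
Theorem theorem9 :
  exists (P : program) (C : nat),
    forall (n k : nat) (w : seq nat),
      (1 <= n)%N -> (2 <= k)%N -> size w = n -> word_over k w ->
      exists (t : nat) (cf : config) (mx : nat),
        exec P t (init_config k w) = Some (cf, mx) /\
        cf.2 0 = Z.of_nat (rankB k w) /\
        (t <= C * k * n ^ 3)%N /\
        (mx.+1 <= C * n)%N.
Proof.
(* 300 is the time constant; it also covers the [129 * n + 1] registers. *)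
exists (compile rank_code 0), 300 => n k w n0 k2 sw kw.
set u := [seq x.-1 | x <- w].
have wu : w = [seq x.+1 | x <- u].
  (* Letters are at least 1, so decrementing them loses nothing. *)
  rewrite -map_comp -[LHS]map_id; apply/eq_in_map => x /(allP kw) /=; lia.
have su : size u = n by rewrite size_map.
have ku : all (ltn^~ k) u.
  by rewrite all_map; apply: sub_all kw => x /=; lia.
have k0 : 0 < k by lia.
have [|t [m [tT r Em]]] := wp_rank_code k n u n0 k0 su ku (compile rank_code 0) 0.
  by move=> i _; rewrite add0n.
rewrite -wu in r Em.
have [|mx mxS ex] := reach_exec _ _ _ _ _ r.
  (* The program stops by running off its end, where [nth] returns the default [IHalt]. *)
  by rewrite /step add0n nth_default.
exists t, (0 + size (compile rank_code 0), m), mx; split=> //; split=> //; split=> //.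
by lia.
Qed.
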